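(* Let $\lambda>0$ and consider the twisted $D_2Q_4$ scheme relative to $\tilde u=0$, with equilibrium moments $m^{eq}(0)=(\rho,0,0,0)$ (advection velocity $V=0$) and relaxation parameters $s=(0,s_q,s_q,s_{xy})\in\mathbb{R}^4$. The associated matrix $J(0)$ has a pre-structure of stability. Moreover, if $0\le s_q,s_{xy}\le2$, then $J(0)$ has a structure of stability. The collision matrix $R(0)$ is then stable for $\|\cdot\|_P$ and the scheme is stable in the norm $\|\cdot\|_{P,\mathcal{L}}$, where $P$ is a matrix realizing the structure of stability.
   Context: Twisted $D_2Q_4$ scheme. Let $\Delta x,\Delta t>0$, $\lambda=\Delta x/\Delta t$, and let $\mathcal{L}$ be the lattice $\Delta x\,\mathbb{Z}^2$ or a finite periodic quotient of it. Velocities: $v_0=(\lambda,\lambda)$, $v_1=(-\lambda,\lambda)$, $v_2=(-\lambda,-\lambda)$, $v_3=(\lambda,-\lambda)$. Moment polynomials: $P_0=1$, $P_1=X$, $P_2=Y$, $P_3=XY$. For $\tilde u\in\mathbb{R}^2$, $M(\tilde u)$ is the invertible matrix $M(\tilde u)_{kj}=P_k(v_j-\tilde u)$. For $f=(f_0,\dots,f_3)$ put $\rho=\sum_jf_j$, $m=M(\tilde u)f$. One time step is: relaxation at each node $m_k^*=m_k+s_k(m_k^{eq}-m_k)$, with $m^{eq}$ a given linear function of $\rho$; $f^*=M(\tilde u)^{-1}m^*$; transport $f_j(x,t+\Delta t)=f_j^*(x-v_j\Delta t,t)$. Let $B$ be the matrix with $f^{eq}:=M(\tilde u)^{-1}m^{eq}=Bf$,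 $D=\mathrm{diag}(s)$, $J(\tilde u)=M(\tilde u)^{-1}DM(\tilde u)(B-I)$, and $R(\tilde u)=I+J(\tilde u)$ the collision matrix, so $f^*=R(\tilde u)f$; the scheme reads $f(\cdot,t+\Delta t)=T\,R(\tilde u)f(\cdot,t)$ with $T$ the transport operator. A matrix $N\in M_q(\mathbb{R})$ has a pre-structure of stability if there exist an invertible $P\in M_q(\mathbb{R})$ and vectors $a,p\in\mathbb{R}^q$ with $PNP^{-1}=-\mathrm{diag}(a)$ and ${}^tPP=\mathrm{diag}(p)$; it is a structure of stability if moreover $a_k\in[0,2]$ for all $k$. For invertible $P$ and $y\in\mathbb{R}^q$, $|y|_P=|Py|_2$ (Euclidean norm); $\|R\|_P=\sup_{|y|_P=1}|Ry|_P$; for $g:\mathcal{L}\to\mathbb{R}^q$, $\|g\|_{P,\mathcal{L}}=(\sum_{x\in\mathcal{L}}|g(x)|_P^2)^{1/2}$. An operator (the collision matrix, resp. the amplification operator $TR(\tilde u)$ of the scheme) is stable in a norm if its operator norm is at most $1$. *)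

(* Defs.v *)
From HB Require Import structures.
From mathcomp Require Import all_boot all_order all_algebra.
From mathcomp Require Import all_classical all_reals all_analysis.

Set Implicit Arguments.
Unset Strict Implicit.
Unset Printing Implicit Defensive.

Import Order.TTheory GRing.Theory Num.Theory.
Local Open Scope classical_set_scope.
Local Open Scope ring_scope.

Definition rowseq (R : realType) (n : nat) (s : seq R) : 'rV[R]_n :=
  \row_(i < n) s`_i.

Section Scheme.
Variable R : realType.

Definition velocity (lambda : R) (j : 'I_4) : 'rV[R]_2 :=
  rowseq 2 (nth [::] [:: [:: lambda; lambda]; [:: - lambda; lambda];
                         [:: - lambda; - lambda]; [:: lambda; - lambda]] j).

Definition moment_poly (k : 'I_4) (w : 'rV[R]_2) : R :=
  let X := w 0 0 in let Y := w 0 1 in [:: 1; X; Y; X * Y]`_k.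

Definition moment_mx (lambda : R) (u : 'rV[R]_2) : 'M[R]_4 :=
  \matrix_(k, j) moment_poly k (velocity lambda j - u).

Definition density (f : 'cV[R]_4) : R := \sum_j f j 0.

(* The equilibrium moments are the linear function rho |-> rho *: c of the
   density; they are given by their coefficient vector c. *)
Definition relax (lambda : R) (u : 'rV[R]_2) (c : 'cV[R]_4) (s : 'rV[R]_4)
    (f : 'cV[R]_4) : 'cV[R]_4 :=
  let m := moment_mx lambda u *m f in
  let meq := density f *: c in
  invmx (moment_mx lambda u) *m \col_k (m k 0 + s 0 k * (meq k 0 - m k 0)).

(* [const_mx 1 : 'rV_4] is the matrix of the density. *)
Definition equilibrium_mx (lambda : R) (u : 'rV[R]_2) (c : 'cV[R]_4) :
    'M[R]_4 :=
  invmx (moment_mx lambda u) *m (c *m (const_mx 1 : 'rV[R]_4)).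

Definition J_mx (lambda : R) (u : 'rV[R]_2) (c : 'cV[R]_4) (s : 'rV[R]_4) :
    'M[R]_4 :=
  invmx (moment_mx lambda u) *m diag_mx s *m moment_mx lambda u
    *m (equilibrium_mx lambda u c - 1%:M).

Definition collision_mx (lambda : R) (u : 'rV[R]_2) (c : 'cV[R]_4)
    (s : 'rV[R]_4) : 'M[R]_4 :=
  1%:M + J_mx lambda u c s.

Lemma equilibrium_mxE lambda u c f :
  equilibrium_mx lambda u c *m f
  = invmx (moment_mx lambda u) *m (density f *: c).
Proof.
rewrite /equilibrium_mx -!mulmxA; congr (_ *m _).
apply/matrixP => k i; rewrite [i]ord1 !mxE big_ord1 !mxE mulrC; congr (_ * _).
by apply: eq_bigr => j _; rewrite mxE mul1r.
Qed.

Lemma collision_mxE lambda u c s f : moment_mx lambda u \in unitmx ->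
  collision_mx lambda u c s *m f = relax lambda u c s f.
Proof.
move=> uM; rewrite /collision_mx mulmxDl mul1mx /J_mx -!mulmxA mulmxBl mul1mx.
rewrite equilibrium_mxE mulmxBr mulKVmx// -{1}[f](mulKmx uM) -mulmxDr /relax.
congr (_ *m _); apply/matrixP => k i; rewrite [i]ord1 mul_diag_mx.
rewrite [LHS]mxE [X in _ + X]mxE [RHS]mxE; congr (_ + _ * _).
by rewrite [LHS]mxE; congr (_ + _); rewrite mxE.
Qed.

Definition grid (dx : R) : set 'rV[R]_2 :=
  [set dx *: map_mx intr z | z in [set: 'rV[int]_2]].

Definition period_group (dx : R) (G : set 'rV[R]_2) : Prop :=
  [/\ G `<=` grid dx, G 0 & forall x y, G x -> G y -> G (x - y)].

(* A node of the quotient of the grid by a group of periods G is a coset of G,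
   seen as a set of points. *)
Definition coset_node (G : set 'rV[R]_2) (x : 'rV[R]_2) : set 'rV[R]_2 :=
  [set x + g | g in G].

(* G = [set 0] gives the grid itself, whose points are seen as singletons. *)
Definition is_lattice (dx : R) (L : set (set 'rV[R]_2)) : Prop :=
  exists G, [/\ period_group dx G,
                L = [set coset_node G x | x in grid dx]
              & G = [set 0] \/ finite_set L].

(* A field g : L -> R^4 is a function on all sets of points, of which only the
   values on L are used by the transport and by the norms. *)
Definition field := set 'rV[R]_2 -> 'cV[R]_4.

Definition shift_node (C : set 'rV[R]_2) (v : 'rV[R]_2) : set 'rV[R]_2 :=
  [set x - v | x in C].

Definition transport (lambda dt : R) (f : field) : field :=
  fun x => \col_j f (shift_node x (dt *: velocity lambda j)) j 0.

Definition amplification (lambda dt : R) (u : 'rV[R]_2) (c : 'cV[R]_4)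
    (s : 'rV[R]_4) (f : field) : field :=
  transport lambda dt (fun x => collision_mx lambda u c s *m f x).

End Scheme.

Section Stability.
Variable R : realType.

Definition pre_structure_by (q : nat) (P N : 'M[R]_q) (a p : 'rV[R]_q) :
    Prop :=
  [/\ P \in unitmx, P *m N *m invmx P = - diag_mx a
    & P^T *m P = diag_mx p].

Definition has_pre_structure (q : nat) (N : 'M[R]_q) : Prop :=
  exists P a p, pre_structure_by P N a p.

Definition structure_by (q : nat) (P N : 'M[R]_q) : Prop :=
  exists a p, pre_structure_by P N a p /\ forall k, 0 <= a 0 k <= 2.

Definition has_structure (q : nat) (N : 'M[R]_q) : Prop :=
  exists P, structure_by P N.

Definition norm2 (q : nat) (y : 'cV[R]_q) : R :=
  Num.sqrt (\sum_k y k 0 ^+ 2).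

Definition normP (q : nat) (P : 'M[R]_q) (y : 'cV[R]_q) : R :=
  norm2 (P *m y).

Definition opnormP (q : nat) (P A : 'M[R]_q) : \bar R :=
  ereal_sup [set (normP P (A *m y))%:E | y in [set y | normP P y = 1]].

Definition stable_matrix (q : nat) (P A : 'M[R]_q) : Prop :=
  (opnormP P A <= 1)%E.

(* Infinite when g is not square summable on L. *)
Definition lattice_norm (P : 'M[R]_4) (L : set (set 'rV[R]_2))
    (g : field R) : \bar R :=
  sqrte (\esum_(x in L) ((normP P (g x)) ^+ 2)%:E).

Definition lattice_opnorm (P : 'M[R]_4) (L : set (set 'rV[R]_2))
    (A : field R -> field R) : \bar R :=
  ereal_sup [set lattice_norm P L (A g)
            | g in [set g | lattice_norm P L g = 1%E]].

Definition stable_operator (P : 'M[R]_4) (L : set (set 'rV[R]_2))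
    (A : field R -> field R) : Prop :=
  (lattice_opnorm P L A <= 1)%E.

End Stability.

(* Main.v *)
Require Import Defs.
From mathcomp Require Import all_boot all_order all_algebra.
From mathcomp Require Import all_classical all_reals all_analysis.
From mathcomp Require Import ring lra.
Import Order.TTheory GRing.Theory Num.Theory.
Local Open Scope classical_set_scope.
Local Open Scope ring_scope.

(** The untwisted moment matrix M has mutually orthogonal rows: after dividing
    its rows by 1, lambda, lambda, lambda^2 it becomes the moment matrix H of
    unit velocity, a 4 x 4 Hadamard matrix, for which H^T H = 4 I.  In the basis
    of moments the equilibrium keeps the density and kills the other moments,
    and the relaxation rates are the diagonal matrix of s; as the density has
    rate 0, M J M^-1 = - diag s.  The rescaling of the rows is diagonal and
    commutes with diag s, so H J H^-1 = - diag s as well, and H realizes the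
    pre-structure, with a = s.

    Stability holds for every P realizing a structure of stability.  The
    identity P J P^-1 = - diag a diagonalizes I + J with entries 1 - a_k, which
    lie in [-1, 1] as a_k is in [0, 2] ([normP_collision_le]).  The identity
    P^T P = diag p turns the squared norm into a weighted sum of the squares of
    the coordinates ([sqr_normP]).  The transport moves each coordinate by its
    own translation, which permutes the nodes as v_j dt is a vector of the grid
    ([shift_node_bij]), so it preserves the lattice norm
    ([lattice_norm_transport]), and the amplification inherits the contraction
    of the collision node by node. *)

(** * The moment matrix *)

Section Moments.
Set Implicit Arguments.
Unset Strict Implicit.
Variable R : realType.
Implicit Types (lambda : R) (s : 'rV[R]_4).

Definition moment_scaling lambda : 'rV[R]_4 :=
  rowseq 4 [:: 1; lambda; lambda; lambda ^+ 2].

(** The moment polynomials are homogeneous and the velocities proportional to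
    lambda. *)
Lemma moment_mx_scaling lambda :
  moment_mx lambda 0 = diag_mx (moment_scaling lambda) *m moment_mx 1 0.
Proof.
apply/matrixP => i j; rewrite mul_diag_mx !mxE /moment_poly !mxE.
case: i => [[|[|[|[|//]]]] ?]; case: j => [[|[|[|[|//]]]] ?] /=; ring.
Qed.

Lemma moment_mx1_mul_tr :
  moment_mx 1 0 *m (4^-1 *: (moment_mx 1 0)^T) = 1%:M :> 'M[R]_4.
Proof.
have HHt : moment_mx 1 0 *m (moment_mx 1 0)^T = 4%:M :> 'M[R]_4.
  apply/matrixP => i j; rewrite mxE !big_ord_recl big_ord0 !mxE.
  rewrite /moment_poly !mxE.
  by case: i => [[|[|[|[|//]]]] ?]; case: j => [[|[|[|[|//]]]] ?] /=; ring.
by rewrite -scalemxAr HHt scale_scalar_mx mulVf ?pnatr_eq0.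
Qed.

Lemma moment_mx1_unit : moment_mx 1 0 \in @unitmx R 4.
Proof. by have [] := mulmx1_unit moment_mx1_mul_tr. Qed.

Lemma moment_mx1_tr_mul : (moment_mx 1 0)^T *m moment_mx 1 0 = 4%:M :> 'M[R]_4.
Proof.
have := mulmx1C moment_mx1_mul_tr.
rewrite -scalemxAl => /(congr1 (fun A => 4 *: A)).
by rewrite scalerA mulfV ?pnatr_eq0// scale1r scale_scalar_mx mulr1.
Qed.

Lemma moment_scaling_unit lambda :
  lambda != 0 -> diag_mx (moment_scaling lambda) \in unitmx.
Proof.
move=> l0; rewrite unitmxE det_diag unitfE; apply/prodf_neq0 => i _.
rewrite mxE; case: i => [[|[|[|[|//]]]] ?] //=.
exact: expf_neq0.
Qed.

Lemma moment_mx_unit lambda : lambda != 0 -> moment_mx lambda 0 \in unitmx.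
Proof.
move=> l0; rewrite moment_mx_scaling unitmx_mul moment_scaling_unit//.
exact: moment_mx1_unit.
Qed.

(** The density is the moment of the constant polynomial: this is what makes
    the equilibrium a matrix of rank one in the basis of moments. *)
Lemma density_row lambda :
  const_mx 1 = delta_mx 0 0 *m moment_mx lambda 0 :> 'rV[R]_4.
Proof. by apply/rowP => j; rewrite -rowE !mxE. Qed.

(** In the basis of moments the equilibrium is the projection on the density,
    so relaxing towards it subtracts diag s except on the density, whose rate
    vanishes anyway. *)
Lemma J_mx_moments lambda s : lambda != 0 -> s 0 0 = 0 ->
  moment_mx lambda 0 *m J_mx lambda 0 (delta_mx 0 0) s
  = - diag_mx s *m moment_mx lambda 0.
Proof.
move=> l0 s0; have uM := moment_mx_unit l0.
rewrite /J_mx /equilibrium_mx (density_row lambda) -!mulmxA mulKVmx// mulmxBr.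
rewrite mulKVmx// mulmx1 mulmxBr !mulmxA mulNmx -[RHS]add0r; congr (_ + _).
suff -> : diag_mx s *m delta_mx 0 0 = 0 :> 'cV[R]_4 by rewrite !mul0mx.
apply/matrixP => i j; rewrite mul_diag_mx !mxE.
by case: eqP => [->|_]; rewrite ?s0 ?mul0r ?mulr0.
Qed.

(** * The structure of stability *)

Lemma pre_structure_by_moment_mx1 lambda s : lambda != 0 -> s 0 0 = 0 ->
  pre_structure_by (moment_mx 1 0) (J_mx lambda 0 (delta_mx 0 0) s) s
    (const_mx 4).
Proof.
move=> l0 s0; split; first exact: moment_mx1_unit.
  have /(congr1 (mulmx (invmx (diag_mx (moment_scaling lambda))))) :=
    J_mx_moments l0 s0.
  rewrite moment_mx_scaling -mulmxA mulKmx ?moment_scaling_unit// => ->.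
  (* the diagonal matrices of s and of the scaling commute *)
  rewrite mulNmx (mulmxA (diag_mx s)) diag_mxC -(mulmxA (diag_mx _)) mulmxN.
  by rewrite mulKmx ?moment_scaling_unit// mulNmx mulmxK// moment_mx1_unit.
by rewrite diag_const_mx moment_mx1_tr_mul.
Qed.

End Moments.

Section Contraction.
Set Implicit Arguments.
Unset Strict Implicit.
Variables (R : realType) (q : nat).
Implicit Types (P N : 'M[R]_q) (y : 'cV[R]_q).

Lemma normP_ge0 P y : 0 <= normP P y.
Proof. exact: sqrtr_ge0. Qed.

Lemma sqr_normPE P y : normP P y ^+ 2 = \sum_k (P *m y) k 0 ^+ 2.
Proof. by rewrite sqr_sqrtr// sumr_ge0// => k _; exact: sqr_ge0. Qed.

Lemma normP_collision_le P N y :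
  structure_by P N -> normP P ((1%:M + N) *m y) <= normP P y.
Proof.
move=> [a [p [[uP PN _] ha]]].
rewrite -(ler_pXn2r (n := 2))// ?nnegrE ?normP_ge0// !sqr_normPE.
apply: ler_sum => k _.
have -> : (P *m ((1%:M + N) *m y)) k 0 = (1 - a 0 k) * (P *m y) k 0.
  have -> : P *m ((1%:M + N) *m y) = P *m y - diag_mx a *m (P *m y).
    rewrite mulmxDl mul1mx mulmxDr; congr (_ + _).
    by rewrite -mulNmx -PN -!mulmxA (mulKmx uP).
  by rewrite mul_diag_mx !mxE mulrBl mul1r.
have /andP[a0 a2] := ha k.
rewrite exprMn ler_piMl ?sqr_ge0//; nra.
Qed.

Lemma stable_matrix_structure P N :
  structure_by P N -> stable_matrix P (1%:M + N).
Proof.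
move=> PN; apply: ge_ereal_sup => _ /= [y y1 <-].
by rewrite lee_fin -[leRHS]y1 normP_collision_le.
Qed.

(** The weights are nonnegative, being the squared lengths of the columns of
    P. *)
Lemma sqr_normP P (p : 'rV[R]_q) : P^T *m P = diag_mx p ->
  (forall j, 0 <= p 0 j) /\
  (forall y, normP P y ^+ 2 = \sum_j p 0 j * y j 0 ^+ 2).
Proof.
move=> PP; split=> [j|y].
  have -> : p 0 j = (P^T *m P) j j by rewrite PP mxE eqxx mulr1n.
  by rewrite mxE sumr_ge0// => k _; rewrite mxE -expr2 sqr_ge0.
have -> : normP P y ^+ 2 = ((P *m y)^T *m (P *m y)) 0 0.
  by rewrite sqr_normPE mxE; apply: eq_bigr => k _; rewrite [in RHS]mxE -expr2.
rewrite trmx_mul -mulmxA (mulmxA P^T) PP mxE; apply: eq_bigr => j _.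
by rewrite mul_diag_mx !mxE mulrCA -expr2.
Qed.

End Contraction.

(** * The transport on the lattice *)

Section Transport.
Set Implicit Arguments.
Unset Strict Implicit.
Variable R : realType.
Implicit Types (dx dt lambda : R) (v : 'rV[R]_2) (L : set (set 'rV[R]_2)).
Implicit Types (P : 'M[R]_4) (f g : field R).

Lemma shift_nodeK v : cancel (@shift_node R ^~ v) (@shift_node R ^~ (- v)).
Proof.
move=> C; apply/seteqP; split=> x /=.
  by move=> [_ [y Cy <-] <-]; rewrite opprK subrK.
by move=> Cx; exists (x - v); [exists x | rewrite opprK subrK].
Qed.

Lemma gridB dx x v : grid dx x -> grid dx v -> grid dx (x - v).
Proof.
move=> [z _ <-] [w _ <-]; exists (z - w) => //.
by rewrite raddfB scalerBr.
Qed.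

Lemma gridN dx v : grid dx v -> grid dx (- v).
Proof. by move=> [z _ <-]; exists (- z) => //; rewrite raddfN scalerN. Qed.

Lemma shift_coset_node (G : set 'rV[R]_2) x v :
  shift_node (coset_node G x) v = coset_node G (x - v).
Proof.
apply/seteqP; split=> y /=.
  by move=> [_ [g Gg <-] <-]; exists g => //; rewrite addrAC.
by move=> [g Gg <-]; exists (x + g); [exists g | rewrite addrAC].
Qed.

Lemma shift_node_lattice dx L v C :
  is_lattice dx L -> grid dx v -> L C -> L (shift_node C v).
Proof.
move=> [G [_ -> _]] gv [x gx <-].
by exists (x - v); [exact: gridB | rewrite shift_coset_node].
Qed.

Lemma shift_node_bij dx L v :
  is_lattice dx L -> grid dx v -> set_bij L L (@shift_node R ^~ v).
Proof.
move=> hL gv; split=> [C|C C' _ _|C LC].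
- exact: (shift_node_lattice hL gv).
- exact: (can_inj (shift_nodeK v)).
- exists (shift_node C (- v)).
    exact: (shift_node_lattice hL (gridN gv)).
  by rewrite -{2}(opprK v) shift_nodeK.
Qed.

Lemma grid_velocity lambda dx dt j : 0 < dt -> lambda = dx / dt ->
  grid dx (dt *: velocity lambda j).
Proof.
move=> dt0 ->; have dtdx : dt * (dx / dt) = dx by rewrite mulrC divfK ?gt_eqF.
exists (\row_i (nth [::] [:: [:: 1; 1]; [:: -1; 1]; [:: -1; -1];
  [:: 1; -1]] j)`_i) => //.
apply/rowP => i; rewrite !mxE.
case: i => [[|[|//]] ?]; case: j => [[|[|[|[|//]]]] ?] /=;
  by rewrite ?mulrN ?dtdx ?rmorphN ?rmorph1 ?mulrN mulr1.
Qed.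

(** The squared norm is a weighted sum over the coordinates, each of which the
    transport merely reindexes by its own bijection of the nodes. *)
Lemma lattice_norm_transport lambda dx dt L P (p : 'rV[R]_4) g :
  0 < dt -> lambda = dx / dt -> is_lattice dx L -> P^T *m P = diag_mx p ->
  lattice_norm P L (transport lambda dt g) = lattice_norm P L g.
Proof.
move=> dt0 hl hL /sqr_normP[p0 normE]; rewrite /lattice_norm; congr sqrte.
pose F j x : \bar R := (p 0 j * g x j 0 ^+ 2)%:E.
have F0 j x : (0 <= F j x)%E by rewrite lee_fin mulr_ge0 ?sqr_ge0.
transitivity (\esum_(x in L) \sum_(j < 4)
    F j (shift_node x (dt *: velocity lambda j)))%E.
  apply: eq_esum => x _; rewrite normE sumEFin; congr EFin.
  by apply: eq_bigr => j _; rewrite mxE.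
transitivity (\esum_(x in L) \sum_(j < 4) F j x)%E; last first.
  by apply: eq_esum => x _; rewrite normE sumEFin.
rewrite !esum_sum//; apply: eq_bigr => j _.
have vgrid := grid_velocity j dt0 hl.
by rewrite [RHS](reindex_esum _ _ _ _ (shift_node_bij hL vgrid)).
Qed.

Lemma le_lattice_norm P L f g :
  (forall x, L x -> normP P (f x) <= normP P (g x)) ->
  (lattice_norm P L f <= lattice_norm P L g)%E.
Proof.
move=> fg; rewrite lee_sqrt; last first.
  by apply: esum_ge0 => x _; rewrite lee_fin sqr_ge0.
apply: le_esum => x Lx; rewrite lee_fin ler_pXn2r ?nnegrE ?normP_ge0//.
exact: fg.
Qed.

Lemma stable_amplification lambda dx dt L P u c (s : 'rV[R]_4) :
  0 < dt -> lambda = dx / dt -> is_lattice dx L ->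
  structure_by P (J_mx lambda u c s) ->
  stable_operator P L (amplification lambda dt u c s).
Proof.
move=> dt0 hl hL PJ; have [a [p [[_ _ PP] _]]] := PJ.
apply: ge_ereal_sup => _ /= [g g1 <-]; rewrite -[leRHS]g1.
rewrite /amplification (lattice_norm_transport _ dt0 hl hL PP).
by apply: le_lattice_norm => x _; exact: normP_collision_le.
Qed.

End Transport.

Theorem proposition4p3 (R : realType) (lambda : R) (sq sxy : R)
    (hlambda : 0 < lambda) :
  let c : 'cV[R]_4 := (rowseq 4 [:: 1; 0; 0; 0])^T in
  let s : 'rV[R]_4 := rowseq 4 [:: 0; sq; sq; sxy] in
  has_pre_structure (J_mx lambda 0 c s) /\
  (0 <= sq <= 2 -> 0 <= sxy <= 2 ->
   has_structure (J_mx lambda 0 c s) /\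
   forall P : 'M[R]_4, structure_by P (J_mx lambda 0 c s) ->
     stable_matrix P (collision_mx lambda 0 c s) /\
     forall (dx dt : R) (L : set (set 'rV[R]_2)),
       0 < dx -> 0 < dt -> lambda = dx / dt -> is_lattice dx L ->
       stable_operator P L (amplification lambda dt 0 c s)).
Proof.
move=> c s.
have pre : pre_structure_by (moment_mx 1 0) (J_mx lambda 0 c s) s (const_mx 4).
  have -> : c = delta_mx 0 0.
    apply/matrixP => i j; rewrite [j]ord1 !mxE andbT.
    by case: i => [[|[|[|[|//]]]] ?].
  by apply: pre_structure_by_moment_mx1; rewrite ?gt_eqF// mxE.
split; first by exists (moment_mx 1 0), s, (const_mx 4).
move=> hq hxy; split=> [|P PJ].
  exists (moment_mx 1 0), s, (const_mx 4); split=> // k.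
  by rewrite mxE; case: k => [[|[|[|[|//]]]] ?] //=; rewrite lexx ler0n.
split=> [|dx dt L _ dt0 hl hL]; first exact: stable_matrix_structure.
exact: (stable_amplification dt0 hl hL).
Qed.
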